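(* Let $(M,\mathfrak g,f)$ be a $3$-Lie algebra in $\mathcal{LM}$ and let $N=(N_0,N_1)$, with $N_0:\mathfrak g\to\mathfrak g$ and $N_1:M\to M$ linear, be a Nijenhuis operator on it. Then a second-order deformation of $(M,\mathfrak g,f)$, $$f_\lambda=f+\lambda\theta,\quad [x_1,x_2,x_3]_\lambda=[x_1,x_2,x_3]+\lambda\omega_1(x_1,x_2,x_3)+\lambda^2\omega_2(x_1,x_2,x_3),$$ $$[x_1,x_2,m]_\lambda=[x_1,x_2,m]+\lambda\nu_1(x_1,x_2,m)+\lambda^2\nu_2(x_1,x_2,m),$$ is obtained by putting $$\theta(m)=(fN_1-N_0f)(m),$$ $$\omega_1(x_1,x_2,x_3)=[N_0x_1,x_2,x_3]+[x_1,N_0x_2,x_3]+[x_1,x_2,N_0x_3]-N_0[x_1,x_2,x_3],$$ $$\omega_2(x_1,x_2,x_3)=[N_0x_1,N_0x_2,x_3]+[N_0x_1,x_2,N_0x_3]+[x_1,N_0x_2,N_0x_3]-N_0\,\omega_1(x_1,x_2,x_3),$$ $$\nu_1(x_1,x_2,m)=[N_0x_1,x_2,m]+[x_1,N_0x_2,m]+[x_1,x_2,N_1m]-N_1[x_1,x_2,m],$$ $$\nu_2(x_1,x_2,m)=[N_0x_1,N_0x_2,m]+[N_0x_1,x_2,N_1m]+[x_1,N_0x_2,N_1m]-N_1\,\nu_1(x_1,x_2,m).$$ Furthermore, this deformation is trivial.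
   Context: All vector spaces are over a fixed field; a linear map out of $\wedge^k$ is the same as an alternating $k$-linear map. A $3$-Lie algebra is a vector space $\mathfrak g$ with a linear map $[\cdot,\cdot,\cdot]:\wedge^3\mathfrak g\to\mathfrak g$ satisfying $[x_1,x_2,[y_1,y_2,y_3]]=[[x_1,x_2,y_1],y_2,y_3]+[y_1,[x_1,x_2,y_2],y_3]+[y_1,y_2,[x_1,x_2,y_3]]$. A representation of $\mathfrak g$ on $M$ is a linear map $\rho:\wedge^2\mathfrak g\to\mathfrak{gl}(M)$, written $[x_1,x_2,m]:=\rho(x_1,x_2)(m)$, with (R1) $[x_1,x_2,[y_1,y_2,m]]=[[x_1,x_2,y_1],y_2,m]+[y_1,[x_1,x_2,y_2],m]+[y_1,y_2,[x_1,x_2,m]]$; (R2) $[x,[y_1,y_2,y_3],m]=[y_2,y_3,[x,y_1,m]]-[y_1,y_3,[x,y_2,m]]+[y_1,y_2,[x,y_3,m]]$. A $3$-Lie algebra in $\mathcal{LM}$, $(M,\mathfrak g,f)$, consists of a $3$-Lie algebra $\mathfrak g$, a representation of $\mathfrak g$ on $M$, and a linear map $f:M\to\mathfrak g$ with $f([x_1,x_2,m])=[x_1,x_2,f(m)]$. A second-order deformation is a family $(f_\lambda,[\cdot,\cdot,\cdot]_\lambda)$ of the displayed form, with $\theta:M\to\mathfrak g$, $\omega_1,\omega_2:\wedge^3\mathfrak g\to\mathfrak g$, $\nu_1,\nu_2:\wedge^2\mathfrak g\otimes M\to M$ linear, such that all axioms of a $3$-Lie algebra in $\mathcal{LM}$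 hold for it as polynomial identities in the formal parameter $\lambda$. It is trivial if there are linear maps $N_0:\mathfrak g\to\mathfrak g$, $N_1:M\to M$ such that $T_0=\mathrm{id}+\lambda N_0$, $T_1=\mathrm{id}+\lambda N_1$ form a homomorphism from the deformed structure to $(M,\mathfrak g,f)$, i.e. $fT_1(m)=T_0f_\lambda(m)$, $T_0([x_1,x_2,x_3]_\lambda)=[T_0x_1,T_0x_2,T_0x_3]$, $T_1([x_1,x_2,m]_\lambda)=[T_0x_1,T_0x_2,T_1m]$. $N=(N_0,N_1)$ is a Nijenhuis operator if for all $x_j\in\mathfrak g$, $m\in M$: $N_0(fN_1-N_0f)=0$; $[N_0x_1,N_0x_2,N_0x_3]=N_0\big([N_0x_1,N_0x_2,x_3]+[N_0x_1,x_2,N_0x_3]+[x_1,N_0x_2,N_0x_3]\big)-N_0^2\big([N_0x_1,x_2,x_3]+[x_1,N_0x_2,x_3]+[x_1,x_2,N_0x_3]\big)+N_0^3[x_1,x_2,x_3]$; $[N_0x_1,N_0x_2,N_1m]=N_1\big([N_0x_1,N_0x_2,m]+[N_0x_1,x_2,N_1m]+[x_1,N_0x_2,N_1m]\big)-N_1^2\big([N_0x_1,x_2,m]+[x_1,N_0x_2,m]+[x_1,x_2,N_1m]\big)+N_1^3[x_1,x_2,m]$. *)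

(* Defs.v *)
From mathcomp Require Import all_boot all_algebra finmap.
From mathcomp.multinomials Require Import monalg.

Set Implicit Arguments.
Unset Strict Implicit.
Unset Printing Implicit Defensive.

Import GRing.Theory.
Local Open Scope ring_scope.

(* The space V[λ] of polynomials in the formal parameter λ with coefficients
   in V: p@_k is the coefficient of λ^k, and << v *g k >> is v λ^k. *)
Notation lpoly V := {malg V[nat]}.

Definition lconst {V : zmodType} (v : V) : lpoly V := << v *g 0%N >>.

(* lmulX k p = λ^k p *)
Definition lmulX {V : zmodType} (k : nat) (p : lpoly V) : lpoly V :=
  \sum_(i <- msupp p) << p@_i *g (k + i)%N >>.

(* λ-linear, resp. λ-trilinear, extensions to polynomial arguments of
   additive, resp. triadditive, maps with values in X[λ]. *)
Definition lext1 {U X : zmodType} (h : U -> lpoly X) (p : lpoly U) : lpoly X :=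
  \sum_(i <- msupp p) lmulX i (h p@_i).

Definition lext3 {U V W X : zmodType} (h : U -> V -> W -> lpoly X)
    (p : lpoly U) (q : lpoly V) (r : lpoly W) : lpoly X :=
  \sum_(i <- msupp p) \sum_(j <- msupp q) \sum_(k <- msupp r)
    lmulX (i + j + k)%N (h p@_i q@_j r@_k).

Section MultilinearMaps.
Variables (F : fieldType) (g M : lmodType F).

(* linear maps ∧^3 g -> g *)
Record alt_trilinear (b : g -> g -> g -> g) : Prop := AltTrilinear {
  alt3_lin1 : forall y z, linear (fun x => b x y z);
  alt3_lin2 : forall x z, linear (fun y => b x y z);
  alt3_lin3 : forall x y, linear (b x y);
  alt3_12 : forall x z, b x x z = 0;
  alt3_23 : forall x y, b x y y = 0;
  alt3_13 : forall x y, b x y x = 0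
}.

(* linear maps ∧^2 g ⊗ M -> M, equivalently ∧^2 g -> gl(M) *)
Record alt_bilinear_action (r : g -> g -> M -> M) : Prop := AltBilinearAction {
  alt2_lin1 : forall y m, linear (fun x => r x y m);
  alt2_lin2 : forall x m, linear (fun y => r x y m);
  alt2_lin3 : forall x y, linear (r x y);
  alt2_12 : forall x m, r x x m = 0
}.
End MultilinearMaps.

(* The identities of a 3-Lie algebra in LM for operations br, rho, f on G and W,
   tested on the arguments cg x (x : X) and cM m (m : Y).  With cg = cM = id
   these are the identities of an ordinary structure; for a deformation,
   G = g[λ], W = M[λ], and the arguments are the constants x ∈ g, m ∈ M. *)
Record LM3Lie_identities (X Y : Type) (G W : zmodType)
    (cg : X -> G) (cM : Y -> W)
    (br : G -> G -> G -> G) (rho : G -> G -> W -> W) (f : W -> G) : Prop :=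
  LM3LieIdentities {
  fundamental_identity : forall x1' x2' y1' y2' y3' : X,
    let x1 := cg x1' in let x2 := cg x2' in
    let y1 := cg y1' in let y2 := cg y2' in let y3 := cg y3' in
    br x1 x2 (br y1 y2 y3) =
      br (br x1 x2 y1) y2 y3 + br y1 (br x1 x2 y2) y3 + br y1 y2 (br x1 x2 y3);
  representation_R1 : forall (x1' x2' y1' y2' : X) (m' : Y),
    let x1 := cg x1' in let x2 := cg x2' in
    let y1 := cg y1' in let y2 := cg y2' in let m := cM m' in
    rho x1 x2 (rho y1 y2 m) =
      rho (br x1 x2 y1) y2 m + rho y1 (br x1 x2 y2) m + rho y1 y2 (rho x1 x2 m);
  representation_R2 : forall (x' y1' y2' y3' : X) (m' : Y),
    let x := cg x' in
    let y1 := cg y1' in let y2 := cg y2' in let y3 := cg y3' in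
    let m := cM m' in
    rho x (br y1 y2 y3) m =
      rho y2 y3 (rho x y1 m) - rho y1 y3 (rho x y2 m) + rho y1 y2 (rho x y3 m);
  equivariance : forall (x1' x2' : X) (m' : Y),
    let x1 := cg x1' in let x2 := cg x2' in let m := cM m' in
    f (rho x1 x2 m) = br x1 x2 (f m)
}.

Section LM3Lie.
Variables (F : fieldType) (g M : lmodType F).
Variables (br : g -> g -> g -> g) (rho : g -> g -> M -> M) (f : M -> g).

Record is_LM3Lie : Prop := IsLM3Lie {
  LM3Lie_br : alt_trilinear br;
  LM3Lie_rho : alt_bilinear_action rho;
  LM3Lie_f : linear f;
  LM3Lie_ids : LM3Lie_identities id id br rho f
}.

Record is_nijenhuis (N0 : g -> g) (N1 : M -> M) : Prop := IsNijenhuis {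
  nijenhuis_f : forall m, N0 (f (N1 m) - N0 (f m)) = 0;
  nijenhuis_br : forall x1 x2 x3,
    br (N0 x1) (N0 x2) (N0 x3) =
      N0 (br (N0 x1) (N0 x2) x3 + br (N0 x1) x2 (N0 x3) + br x1 (N0 x2) (N0 x3))
      - N0 (N0 (br (N0 x1) x2 x3 + br x1 (N0 x2) x3 + br x1 x2 (N0 x3)))
      + N0 (N0 (N0 (br x1 x2 x3)));
  nijenhuis_rho : forall x1 x2 m,
    rho (N0 x1) (N0 x2) (N1 m) =
      N1 (rho (N0 x1) (N0 x2) m + rho (N0 x1) x2 (N1 m) + rho x1 (N0 x2) (N1 m))
      - N1 (N1 (rho (N0 x1) x2 m + rho x1 (N0 x2) m + rho x1 x2 (N1 m)))
      + N1 (N1 (N1 (rho x1 x2 m)))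
}.

Section Deformation.
Variables (theta : M -> g) (omega1 omega2 : g -> g -> g -> g).
Variables (nu1 nu2 : g -> g -> M -> M).

Definition f_l (m : M) : lpoly g := << f m *g 0%N >> + << theta m *g 1%N >>.

Definition br_l (x1 x2 x3 : g) : lpoly g :=
  << br x1 x2 x3 *g 0%N >> + << omega1 x1 x2 x3 *g 1%N >>
  + << omega2 x1 x2 x3 *g 2%N >>.

Definition rho_l (x1 x2 : g) (m : M) : lpoly M :=
  << rho x1 x2 m *g 0%N >> + << nu1 x1 x2 m *g 1%N >>
  + << nu2 x1 x2 m *g 2%N >>.

Record is_second_order_deformation : Prop := IsSecondOrderDeformation {
  deformation_theta : linear theta;
  deformation_omega1 : alt_trilinear omega1;
  deformation_omega2 : alt_trilinear omega2;
  deformation_nu1 : alt_bilinear_action nu1;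
  deformation_nu2 : alt_bilinear_action nu2;
  deformation_ids :
    LM3Lie_identities lconst lconst (lext3 br_l) (lext3 rho_l) (lext1 f_l)
}.

(* id + λ N *)
Definition id_plus_l (V : zmodType) (N : V -> V) (v : V) : lpoly V :=
  << v *g 0%N >> + << N v *g 1%N >>.

Definition is_trivial_deformation : Prop :=
  exists (N0 : {linear g -> g}) (N1 : {linear M -> M}),
    let T0 := id_plus_l N0 in
    let T1 := id_plus_l N1 in
    let f0 := lext1 (fun m => lconst (f m)) in
    let br0 := lext3 (fun x1 x2 x3 => lconst (br x1 x2 x3)) in
    let rho0 := lext3 (fun x1 x2 m => lconst (rho x1 x2 m)) in
    [/\ forall m, f0 (T1 m) = lext1 T0 (f_l m),
        forall x1 x2 x3,
          lext1 T0 (br_l x1 x2 x3) = br0 (T0 x1) (T0 x2) (T0 x3)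
      & forall x1 x2 m,
          lext1 T1 (rho_l x1 x2 m) = rho0 (T0 x1) (T0 x2) (T1 m)].
End Deformation.
End LM3Lie.

(* Main.v *)
(** The polynomial map [T = id + λN] is injective on [V[λ]] for every additive
    [N]: the lowest coefficient of [p] is that of [T p], and the others follow
    recursively.  The Nijenhuis conditions say exactly that [T] intertwines the
    deformed operations with the λ-linear extensions of the original ones (the
    coefficients of [λ^0], [λ^1] and [λ^2] agree by the choice of [θ, ω_i, ν_i],
    and the top coefficient is the Nijenhuis condition).  So the deformation is
    trivial, and since the extended original structure on [g[λ]], [M[λ]]
    satisfies all identities, pulling them back along the injective [T] gives
    those of the deformed structure. *)
Require Import Defs.
From mathcomp Require Import all_boot all_algebra ssrAC finmap zify.
From mathcomp.multinomials Require Import monalg.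
Import GRing.Theory.
Local Open Scope ring_scope.

Set Implicit Arguments.
Unset Strict Implicit.
Unset Printing Implicit Defensive.

(** * Additive sums over the coefficients of a polynomial in λ *)

Section LambdaSums.
Variables V X : zmodType.
Implicit Types (F G H : nat -> V -> X) (p q : lpoly V).

(** This is the common shape of [lmulX], [lext1] and each of the nested sums in [lext3], so
    additivity and values on monomials are proved once and transferred by conversion. *)
Definition lsum F p : X := \sum_(i <- msupp p) F i p@_i.

Lemma lsum_split F G H p : (forall i v, F i v = G i v + H i v) ->
  lsum F p = lsum G p + lsum H p.
Proof. by move=> FE; rewrite -big_split; apply: eq_bigr. Qed.

Variable F : nat -> V -> X.
Hypothesis FD : forall i, {morph F i : u v / u + v}.

Let F0 i : F i 0 = 0.
Proof. by apply: (addrI (F i 0)); rewrite -FD !addr0. Qed.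

(** Additive maps kill the zero coefficients outside the support. Polynomials with different
    supports can then be summed over one common index set. *)
Lemma lsum_widen p (D : {fset nat}) : (msupp p `<=` D)%fset ->
  lsum F p = \sum_(i <- D) F i p@_i.
Proof.
move=> sD; apply: big_fset_incl => // i _ /mcoeff_outdom ->.
exact: F0.
Qed.

Lemma lsumD : {morph lsum F : p q / p + q}.
Proof.
move=> p q.
rewrite (lsum_widen (msuppD_le p q)) (lsum_widen (fsubsetUl _ (msupp q))).
rewrite (lsum_widen (fsubsetUr (msupp p) _)) -big_split /=.
by apply: eq_bigr => i _; rewrite mcoeffD FD.
Qed.

Lemma lsumU v i : lsum F << v *g i >> = F i v.
Proof. by rewrite (lsum_widen msuppU_le) big_seq_fset1 mcoeffUU. Qed.

End LambdaSums.

(** No case for 0 appears because 0 is itself a monomial with coefficient 0. *)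
Lemma lpoly_ind (V : zmodType) (P : lpoly V -> Prop) :
  (forall v i, P << v *g i >>) -> (forall p q, P p -> P q -> P (p + q)) ->
  forall p, P p.
Proof.
move=> PU PD p; rewrite (monalgE p); apply: big_ind => //.
by have := PU 0 0%N; rewrite monalgU0.
Qed.

(** * Multiplication by powers of λ, and λ-multilinear extensions *)

Section LmulX.
Variable V : zmodType.
Implicit Types (p q : lpoly V) (v : V).

Lemma lmulXD n : {morph @lmulX V n : p q / p + q}.
Proof.
by apply: (lsumD (F := fun i => @mkmalgU _ V (n + i)%N))
  => i u v; rewrite monalgUD.
Qed.

Lemma lmulXU n (v : V) i : lmulX n << v *g i >> = << v *g (n + i)%N >>.
Proof.
by apply: (lsumU (F := fun i => @mkmalgU _ V (n + i)%N))
  => j u w; rewrite monalgUD.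
Qed.

Lemma lmulXA m n p : lmulX m (lmulX n p) = lmulX (m + n)%N p.
Proof.
elim/lpoly_ind: p => [v i | p q IHp IHq]; first by rewrite !lmulXU addnA.
by rewrite !lmulXD IHp IHq.
Qed.

End LmulX.

Section Lext1.
Variables (U X : zmodType) (h : U -> lpoly X).
Hypothesis hD : {morph h : u v / u + v}.

Lemma lext1D : {morph lext1 h : p q / p + q}.
Proof.
by apply: (lsumD (F := fun i v => lmulX i (h v)))
  => i u v; rewrite hD lmulXD.
Qed.

Lemma lext1U v i : lext1 h << v *g i >> = lmulX i (h v).
Proof.
by apply: (lsumU (F := fun i v => lmulX i (h v)))
  => j u w; rewrite hD lmulXD.
Qed.

Lemma lext1_lmulX n p : lext1 h (lmulX n p) = lmulX n (lext1 h p).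
Proof.
elim/lpoly_ind: p => [v i | p q IHp IHq].
  by rewrite lmulXU !lext1U lmulXA.
by rewrite !(lmulXD, lext1D) IHp IHq.
Qed.

End Lext1.

(** Polynomial spaces are treated as abelian groups; scalars from the field enter only through the
    coefficient maps. *)
Record triadditive (U V W X : zmodType) (h : U -> V -> W -> X) : Prop :=
  Triadditive {
  triaddD1 : forall a b y z, h (a + b) y z = h a y z + h b y z;
  triaddD2 : forall x a b z, h x (a + b) z = h x a z + h x b z;
  triaddD3 : forall x y a b, h x y (a + b) = h x y a + h x y b
}.

Section Lext3.
Variables (U V W X : zmodType) (h : U -> V -> W -> lpoly X).
Hypothesis hD : triadditive h.

Let term i j k u v w := lmulX (i + j + k)%N (h u v w).

Lemma lext3E p q r : lext3 h p q r = lsum (fun i u =>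
  lsum (fun j v => lsum (fun k w => term i j k u v w) r) q) p.
Proof. by []. Qed.

Let termD i j k : triadditive (term i j k).
Proof.
case: hD => D1 D2 D3.
by split=> *; rewrite /term ?D1 ?D2 ?D3 lmulXD.
Qed.

(** This and the next two facts stay in the section context, where they discharge the additivity
    conditions of [lsumD] and [lsumU] for the three nested sums. *)
Let lsumD1 i q r : {morph (fun u =>
  lsum (fun j v => lsum (fun k w => term i j k u v w) r) q) : a b / a + b}.
Proof.
by move=> a b; do 2!apply: lsum_split => ? ?; rewrite (triaddD1 (termD _ _ _)).
Qed.

Let lsumD2 i j u r :
  {morph (fun v => lsum (fun k w => term i j k u v w) r) : a b / a + b}.
Proof.
by move=> a b; apply: lsum_split => ? ?; rewrite (triaddD2 (termD _ _ _)).
Qed.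

Let lsumD3 i j k u v : {morph term i j k u v : a b / a + b}.
Proof. by move=> a b; rewrite (triaddD3 (termD _ _ _)). Qed.

Lemma lext3D : triadditive (lext3 h).
Proof.
split=> [p p' q r | p q q' r | p q r r']; rewrite !lext3E.
- exact: lsumD.
- by apply: lsum_split => i u; apply: lsumD.
- by do 2!apply: lsum_split => ? ?; apply: lsumD.
Qed.

Lemma lext3U x y z i j k :
  lext3 h << x *g i >> << y *g j >> << z *g k >> = lmulX (i + j + k)%N (h x y z).
Proof. by rewrite lext3E !lsumU. Qed.

Lemma lext3_lmulX i j k p q r :
  lext3 h (lmulX i p) (lmulX j q) (lmulX k r)
  = lmulX (i + j + k)%N (lext3 h p q r).
Proof.
case: (lext3D) => D1 D2 D3.
elim/lpoly_ind: p => [x a | p p' IH IH'];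
  last by rewrite !(lmulXD, D1) IH IH'.
elim/lpoly_ind: q => [y b | q q' IH IH'];
  last by rewrite !(lmulXD, D2) IH IH'.
elim/lpoly_ind: r => [z c | r r' IH IH'];
  last by rewrite !(lmulXD, D3) IH IH'.
by rewrite !lmulXU !lext3U lmulXA; congr lmulX; lia.
Qed.

End Lext3.

Section ConstantExtension.
Variables (U V W X : zmodType) (b : U -> V -> W -> X) (h : U -> X).
Hypotheses (bD : triadditive b) (hD : {morph h : u v / u + v}).

Lemma lconst1D : {morph (fun u => lconst (h u)) : u v / u + v}.
Proof. by move=> u v; rewrite hD /lconst monalgUD. Qed.

Lemma lconst3D : triadditive (fun x y z => lconst (b x y z)).
Proof.
by case: bD => D1 D2 D3; split=> *; rewrite /lconst ?D1 ?D2 ?D3 monalgUD.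
Qed.

Lemma lext1cU v i : lext1 (fun u => lconst (h u)) << v *g i >> = << h v *g i >>.
Proof. by rewrite (lext1U lconst1D) lmulXU addn0. Qed.

Lemma lext3cU x y z i j k :
  lext3 (fun x y z => lconst (b x y z)) << x *g i >> << y *g j >> << z *g k >>
  = << b x y z *g (i + j + k)%N >>.
Proof. by rewrite (lext3U lconst3D) lmulXU addn0. Qed.

End ConstantExtension.

(** * The map id + λN and the operations it intertwines *)

Section IdPlus.
Variables (V : zmodType) (N : V -> V).
Hypothesis ND : {morph N : u v / u + v}.

Lemma id_plus_lD : {morph id_plus_l N : u v / u + v}.
Proof. by move=> u v; rewrite /id_plus_l ND !monalgUD addrACA. Qed.

Let T := lext1 (id_plus_l N).

Lemma lext1_id_plusD : {morph T : p q / p + q}.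
Proof. exact: lext1D id_plus_lD. Qed.

Lemma lext1_id_plusU v i : T << v *g i >> = << v *g i >> + << N v *g i.+1 >>.
Proof. by rewrite /T (lext1U id_plus_lD) lmulXD !lmulXU addn0 addn1. Qed.

Lemma coef_lext1_id_plus p n :
  (T p)@_n = p@_n + (if n is m.+1 then N p@_m else 0).
Proof.
have N0 : N 0 = 0 by apply: (addrI (N 0)); rewrite -ND !addr0.
elim/lpoly_ind: p => [v i | p q IHp IHq].
  rewrite lext1_id_plusU mcoeffD !mcoeffU; case: n => [|n] //.
  by rewrite mcoeffU eqSS; case: (i == n); rewrite ?N0.
rewrite lext1_id_plusD !mcoeffD {}IHp {}IHq addrACA; congr (_ + _).
by case: n => [|n]; rewrite ?addr0 // mcoeffD ND.
Qed.

Lemma lext1_id_plus_inj : injective T.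
Proof.
move=> p q eqT; apply/malgP; elim=> [|n IHn].
  by have := congr1 (mcoeff 0) eqT; rewrite !coef_lext1_id_plus !addr0.
have := congr1 (mcoeff n.+1) eqT.
by rewrite !coef_lext1_id_plus IHn => /addIr.
Qed.

End IdPlus.

(** Both sides are additive in [p] and commute with multiplication by powers of λ, so agreement on
    constants is enough. *)
Lemma lext1_intertwine (U X : zmodType) (NU : U -> U) (NX : X -> X)
    (b c : U -> lpoly X) :
  {morph NU : u v / u + v} -> {morph NX : u v / u + v} ->
  {morph b : u v / u + v} -> {morph c : u v / u + v} ->
  let TU := id_plus_l NU in let TX := id_plus_l NX in
  (forall x, lext1 TX (b x) = lext1 c (TU x)) ->
  forall p, lext1 TX (lext1 b p) = lext1 c (lext1 TU p).
Proof.
move=> DU DX bD cD TU TX Tb p.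
have TUD := lext1_id_plusD DU; have TXD := lext1_id_plusD DX.
elim/lpoly_ind: p => [x i | p p' IH IH'];
  last by rewrite (lext1D bD) TXD IH IH' TUD (lext1D cD).
rewrite (lext1U bD) (lext1_lmulX (id_plus_lD DX)) Tb -(lext1_lmulX cD).
by rewrite (lext1U (id_plus_lD DU)).
Qed.

(** The reduction to constants is made in each argument separately. Four independent maps let one
    statement serve both the bracket and the action. *)
Lemma lext3_intertwine (U V W X : zmodType) (NU : U -> U) (NV : V -> V)
    (NW : W -> W) (NX : X -> X) (b c : U -> V -> W -> lpoly X) :
  {morph NU : u v / u + v} -> {morph NV : u v / u + v} ->
  {morph NW : u v / u + v} -> {morph NX : u v / u + v} ->
  triadditive b -> triadditive c ->
  let TU := id_plus_l NU in let TV := id_plus_l NV in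
  let TW := id_plus_l NW in let TX := id_plus_l NX in
  (forall x y z, lext1 TX (b x y z) = lext3 c (TU x) (TV y) (TW z)) ->
  forall p q r, lext1 TX (lext3 b p q r)
    = lext3 c (lext1 TU p) (lext1 TV q) (lext1 TW r).
Proof.
move=> DU DV DW DX bD cD TU TV TW TX Tb p q r.
have [bD1 bD2 bD3] := lext3D bD; have [cD1 cD2 cD3] := lext3D cD.
have TUD := lext1_id_plusD DU; have TVD := lext1_id_plusD DV.
have TWD := lext1_id_plusD DW; have TXD := lext1_id_plusD DX.
elim/lpoly_ind: p => [x i | p p' IH IH'];
  last by rewrite bD1 TXD IH IH' TUD cD1.
elim/lpoly_ind: q => [y j | q q' IH IH'];
  last by rewrite bD2 TXD IH IH' TVD cD2.
elim/lpoly_ind: r => [z k | r r' IH IH'];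
  last by rewrite bD3 TXD IH IH' TWD cD3.
rewrite (lext3U bD) (lext1_lmulX (id_plus_lD DX)) Tb -(lext3_lmulX cD).
by rewrite (lext1U (id_plus_lD DU)) (lext1U (id_plus_lD DV))
  (lext1U (id_plus_lD DW)).
Qed.

(** * Transfer of the identities between structures *)

Lemma LM3Lie_identities_restrict (X Y : Type) (G W : zmodType)
    (cg : X -> G) (cM : Y -> W) br rho (f : W -> G) :
  LM3Lie_identities id id br rho f -> LM3Lie_identities cg cM br rho f.
Proof.
case=> FI R1 R2 E; split.
- by move=> *; apply: FI.
- by move=> *; apply: R1.
- by move=> *; apply: R2.
- by move=> *; apply: E.
Qed.

(** Pushing [TG] or [TW] through both sides of an identity turns it into the same identity for the
    primed structure; injectivity brings it back. *)
Lemma LM3Lie_identities_pullback (G W G' W' : zmodType)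
    (TG : G -> G') (TW : W -> W')
    (br : G -> G -> G -> G) (rho : G -> G -> W -> W) (f : W -> G)
    (br' : G' -> G' -> G' -> G') (rho' : G' -> G' -> W' -> W') (f' : W' -> G') :
  {morph TG : p q / p + q} -> {morph TW : p q / p + q} ->
  injective TG -> injective TW ->
  (forall p q r, TG (br p q r) = br' (TG p) (TG q) (TG r)) ->
  (forall p q m, TW (rho p q m) = rho' (TG p) (TG q) (TW m)) ->
  (forall m, TG (f m) = f' (TW m)) ->
  LM3Lie_identities id id br' rho' f' -> LM3Lie_identities id id br rho f.
Proof.
move=> TGD TWD TGI TWI Tbr Trho Tf [FI R1 R2 E].
(* Needed for (R2), the only identity with a minus sign. *)
have TWN p : TW (- p) = - TW p.
  apply: (addrI (TW p)); rewrite -TWD !subrr.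
  by apply: (addrI (TW 0)); rewrite -TWD !addr0.
split=> /=.
- by move=> *; apply: TGI; rewrite !(TGD, Tbr); apply: FI.
- by move=> *; apply: TWI; rewrite !(TWD, Trho, Tbr); apply: R1.
- by move=> *; apply: TWI; rewrite !(TWD, TWN, Trho, Tbr); apply: R2.
- by move=> *; apply: TGI; rewrite !(Tbr, Tf, Trho); apply: E.
Qed.

(** Generation under sums is phrased as an induction principle, so that [elim/] can use it
    directly. *)
Definition additive_generating (X : Type) (G : zmodType) (c : X -> G) :=
  forall P : G -> Prop, (forall x, P (c x)) ->
  (forall p q, P p -> P q -> P (p + q)) -> forall p, P p.

(** Both sides of every identity are additive in each argument, so the arguments can be reduced to
    generators one at a time. *)
Lemma LM3Lie_identities_generating (X Y : Type) (G W : zmodType)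
    (cg : X -> G) (cM : Y -> W)
    (br : G -> G -> G -> G) (rho : G -> G -> W -> W) (f : W -> G) :
  additive_generating cg -> additive_generating cM ->
  triadditive br -> triadditive rho -> {morph f : m n / m + n} ->
  LM3Lie_identities cg cM br rho f -> LM3Lie_identities id id br rho f.
Proof.
move=> Gind Wind [bD1 bD2 bD3] [rD1 rD2 rD3] fD [FI R1 R2 E].
have opsD := (bD1, bD2, bD3, rD1, rD2, rD3, fD).
(* Collects the right-hand sides for [p] and for [q] into the termwise expansion of the one for
   [p + q]. *)
have AC3 (A : zmodType) (a b c a' b' c' : A) :
    a + b + c + (a' + b' + c') = a + a' + (b + b') + (c + c').
  by rewrite addrACA [X in X + _ = _]addrACA.
split=> /=.
- move=> x1 x2 y1 y2 y3.
  elim/Gind: x1 => [x1 | p q IHp IHq]; last by rewrite !opsD IHp IHq AC3.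
  elim/Gind: x2 => [x2 | p q IHp IHq]; last by rewrite !opsD IHp IHq AC3.
  elim/Gind: y1 => [y1 | p q IHp IHq]; last by rewrite !opsD IHp IHq AC3.
  elim/Gind: y2 => [y2 | p q IHp IHq]; last by rewrite !opsD IHp IHq AC3.
  elim/Gind: y3 => [y3 | p q IHp IHq]; last by rewrite !opsD IHp IHq AC3.
  exact: FI.
- move=> x1 x2 y1 y2 m.
  elim/Gind: x1 => [x1 | p q IHp IHq]; last by rewrite !opsD IHp IHq AC3.
  elim/Gind: x2 => [x2 | p q IHp IHq]; last by rewrite !opsD IHp IHq AC3.
  elim/Gind: y1 => [y1 | p q IHp IHq]; last by rewrite !opsD IHp IHq AC3.
  elim/Gind: y2 => [y2 | p q IHp IHq]; last by rewrite !opsD IHp IHq AC3.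
  elim/Wind: m => [m | p q IHp IHq]; last by rewrite !opsD IHp IHq AC3.
  exact: R1.
- move=> x y1 y2 y3 m.
  elim/Gind: x => [x | p q IHp IHq]; last by rewrite !opsD IHp IHq opprD AC3.
  elim/Gind: y1 => [y1 | p q IHp IHq]; last by rewrite !opsD IHp IHq opprD AC3.
  elim/Gind: y2 => [y2 | p q IHp IHq]; last by rewrite !opsD IHp IHq opprD AC3.
  elim/Gind: y3 => [y3 | p q IHp IHq]; last by rewrite !opsD IHp IHq opprD AC3.
  elim/Wind: m => [m | p q IHp IHq]; last by rewrite !opsD IHp IHq opprD AC3.
  exact: R2.
- move=> x1 x2 m.
  elim/Gind: x1 => [x1 | p q IHp IHq]; last by rewrite !opsD IHp IHq.
  elim/Gind: x2 => [x2 | p q IHp IHq]; last by rewrite !opsD IHp IHq.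
  elim/Wind: m => [m | p q IHp IHq]; last by rewrite !opsD IHp IHq.
  exact: E.
Qed.

(** On monomials each identity is the original one multiplied by a single power of λ, and monomials
    generate. *)
Lemma LM3Lie_identities_lpoly (G W : zmodType)
    (br : G -> G -> G -> G) (rho : G -> G -> W -> W) (f : W -> G) :
  triadditive br -> triadditive rho -> {morph f : m n / m + n} ->
  LM3Lie_identities id id br rho f ->
  LM3Lie_identities id id (lext3 (fun x y z => lconst (br x y z)))
    (lext3 (fun x y m => lconst (rho x y m))) (lext1 (fun m => lconst (f m))).
Proof.
move=> brD rhoD fD [FI R1 R2 E].
pose mono (V : zmodType) (vi : V * nat) : lpoly V := << vi.1 *g vi.2 >>.
have monoP V : additive_generating (mono V).
  by move=> P PU PD; apply: lpoly_ind => // v i; apply: PU (v, i).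
apply: (LM3Lie_identities_generating (monoP G) (monoP W)).
- exact: lext3D (lconst3D brD).
- exact: lext3D (lconst3D rhoD).
- exact: lext1D (lconst1D fD).
(* The exponents of the three terms are the same sum in different orders; separate variables leave
   these equalities to [lia]. *)
have mono3 (V : zmodType) (a b c : V) k k1 k2 k3 : k = k1 -> k = k2 -> k = k3 ->
    << a + b + c *g k >>
    = << a *g k1 >> + << b *g k2 >> + << c *g k3 >> :> lpoly V.
  by move=> <- <- <-; rewrite !monalgUD.
rewrite /mono; split=> /=.
- move=> [x1 i1] [x2 i2] [y1 j1] [y2 j2] [y3 j3] /=.
  rewrite !(lext3cU brD) FI.
  by apply: mono3; lia.
- move=> [x1 i1] [x2 i2] [y1 j1] [y2 j2] [m k] /=.
  rewrite !(lext3cU brD, lext3cU rhoD) R1.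
  by apply: mono3; lia.
- move=> [x i] [y1 j1] [y2 j2] [y3 j3] [m k] /=.
  (* The sign is moved into the coefficient to fit the form of [mono3]. *)
  rewrite !(lext3cU brD, lext3cU rhoD) R2 -monalgUN.
  by apply: mono3; lia.
- move=> [x1 i1] [x2 i2] [m k] /=.
  by rewrite (lext3cU rhoD) !(lext1cU fD) (lext3cU brD) E.
Qed.


(** * Nijenhuis deformations of a single trilinear map *)

Section Trilinear.
Variable F : fieldType.

Record trilinear (U V W X : lmodType F) (h : U -> V -> W -> X) : Prop :=
  Trilinear {
  tri_lin1 : forall y z, linear (fun x => h x y z);
  tri_lin2 : forall x z, linear (fun y => h x y z);
  tri_lin3 : forall x y, linear (h x y)
}.

Lemma linear_morphD (U V : lmodType F) (h : U -> V) :
  linear h -> {morph h : u v / u + v}.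
Proof. by move=> hL u v; have := hL 1 u v; rewrite !scale1r. Qed.

Lemma linear_add3_sub (U V : lmodType F) (h1 h2 h3 k : U -> V) :
  linear h1 -> linear h2 -> linear h3 -> linear k ->
  linear (fun u => h1 u + h2 u + h3 u - k u).
Proof.
move=> L1 L2 L3 Lk a u v; rewrite L1 L2 L3 Lk opprD !scalerDr scalerN.
by rewrite [LHS](AC (2 * 2 * 2 * 2) ((1 * 3 * 5 * 7) * (2 * 4 * 6 * 8))).
Qed.

Lemma linear_comp (U V W : lmodType F) (h : V -> W) (k : U -> V) :
  linear h -> linear k -> linear (fun u => h (k u)).
Proof. by move=> hL kL a u v; rewrite kL hL. Qed.

Lemma trilinear_triadditive (U V W X : lmodType F) (h : U -> V -> W -> X) :
  trilinear h -> triadditive h.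
Proof.
case=> L1 L2 L3; split=> [a b y z | x a b z | x y a b].
- exact: (linear_morphD (L1 y z)).
- exact: (linear_morphD (L2 x z)).
- exact: (linear_morphD (L3 x y)).
Qed.

Section Nijenhuis.
Variables (U V W X : lmodType F) (b : U -> V -> W -> X).
Variables (NU : {linear U -> U}) (NV : {linear V -> V}).
Variables (NW : {linear W -> W}) (NX : {linear X -> X}).
Hypothesis bL : trilinear b.

(** [nij1] and [nij2] are forced by comparing the coefficients of λ and λ^2 in the triviality
    equation. Distinct spaces cover both the ω_i and the ν_i. *)
Definition nij1 x y z :=
  b (NU x) y z + b x (NV y) z + b x y (NW z) - NX (b x y z).

Definition nij2 x y z :=
  b (NU x) (NV y) z + b (NU x) y (NW z) + b x (NV y) (NW z) - NX (nij1 x y z).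

Lemma nij1_trilinear : trilinear nij1.
Proof.
case: bL => L1 L2 L3; split=> [y z | x z | x y]; apply: linear_add3_sub;
  do ?[exact: L1 | exact: L2 | exact: L3
     | exact: (linear_comp (L1 _ _) (linearP NU))
     | exact: (linear_comp (L2 _ _) (linearP NV))
     | exact: (linear_comp (L3 _ _) (linearP NW))
     | apply: (linear_comp (linearP NX))].
Qed.

Lemma nij2_trilinear : trilinear nij2.
Proof.
case: bL nij1_trilinear => L1 L2 L3 [M1 M2 M3].
split=> [y z | x z | x y]; apply: linear_add3_sub;
  do ?[exact: L1 | exact: L2 | exact: L3 | exact: M1 | exact: M2 | exact: M3
     | exact: (linear_comp (L1 _ _) (linearP NU))
     | exact: (linear_comp (L2 _ _) (linearP NV))
     | exact: (linear_comp (L3 _ _) (linearP NW))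
     | apply: (linear_comp (linearP NX))].
Qed.

Definition second_order_l (c1 c2 : U -> V -> W -> X) x y z : lpoly X :=
  << b x y z *g 0%N >> + << c1 x y z *g 1%N >> + << c2 x y z *g 2%N >>.

Lemma second_order_lD c1 c2 :
  triadditive c1 -> triadditive c2 -> triadditive (second_order_l c1 c2).
Proof.
move=> [D1 D2 D3] [E1 E2 E3].
have [B1 B2 B3] := trilinear_triadditive bL.
split=> *;
  rewrite /second_order_l ?(B1, D1, E1, B2, D2, E2, B3, D3, E3) !monalgUD;
  by rewrite [LHS](AC (2 * 2 * 2) ((1 * 3 * 5) * (2 * 4 * 6))).
Qed.

Lemma nijenhuis_trivial x y z :
  b (NU x) (NV y) (NW z) = NX (nij2 x y z) ->
  lext1 (id_plus_l NX) (second_order_l nij1 nij2 x y z)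
  = lext3 (fun x y z => lconst (b x y z))
      (id_plus_l NU x) (id_plus_l NV y) (id_plus_l NW z).
Proof.
move=> b3.
have bD := trilinear_triadditive bL; have [D1 D2 D3] := lext3D (lconst3D bD).
rewrite /second_order_l /id_plus_l !(D1, D2, D3) !(lext3cU bD) /= !addn0 !add0n.
(* The eight monomials of the expansion are grouped by degree: one, three, three and one. *)
rewrite [RHS](AC ((2 * 2) * (2 * 2)) (1 * (5 * 3 * 2) * (7 * 6 * 4) * 8)) /=.
have NXD : {morph NX : u v / u + v} by apply: raddfD.
rewrite !(lext1_id_plusD NXD) !(lext1_id_plusU NXD) b3.
(* In degrees 1 and 2 the image under [NX] of the previous coefficient meets the term subtracted in
   [nij1] or [nij2] and cancels it. *)
rewrite (AC (2 * 2 * 2) (1 * (3 * 2) * (5 * 4) * 6)) /= -!monalgUD.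
by rewrite /nij2 !subrK.
Qed.

End Nijenhuis.

(** Polarization: expand [h (x + y) (x + y) = 0]. This form is valid in every characteristic. *)
Lemma alternating_antisym (U X : lmodType F) (h : U -> U -> X) :
  (forall y, linear (h^~ y)) -> (forall x, linear (h x)) ->
  (forall x, h x x = 0) -> forall x y, h x y + h y x = 0.
Proof.
move=> L1 L2 alt x y; have := alt (x + y).
rewrite (linear_morphD (L1 _)) !(linear_morphD (L2 _)) !alt.
by rewrite add0r addr0.
Qed.

(** With equal first arguments, each term either repeats an argument or pairs with another by
    antisymmetry. Only the first two slots share a space, so the action is covered as well. *)
Lemma nij_alt12 (U W X : lmodType F) (b : U -> U -> W -> X)
    (NU : {linear U -> U}) (NW : {linear W -> W}) (NX : {linear X -> X}) :
  trilinear b -> (forall x z, b x x z = 0) -> forall x z,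
  nij1 b NU NU NW NX x x z = 0 /\ nij2 b NU NU NW NX x x z = 0.
Proof.
case=> L1 L2 _ alt x z.
have anti u v w : b u v w + b v u w = 0.
  exact: (alternating_antisym (h := fun u v => b u v w)).
have n1 : nij1 b NU NU NW NX x x z = 0.
  by rewrite /nij1 anti !alt linear0 subr0 addr0.
by split=> //; rewrite /nij2 n1 linear0 alt add0r anti subr0.
Qed.

(** The slots 2, 3 and 1, 3 are handled by the same polarization as the slots 1, 2. *)
Lemma nij_alternating (V : lmodType F) (b : V -> V -> V -> V)
    (N : {linear V -> V}) :
  alt_trilinear b ->
  alt_trilinear (nij1 b N N N N) /\ alt_trilinear (nij2 b N N N N).
Proof.
case=> L1 L2 L3 a12 a23 a13; have bL := Trilinear L1 L2 L3.
have n12 := nij_alt12 N N N bL a12.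
have anti23 x u v : b x u v + b x v u = 0.
  exact: (alternating_antisym (h := b x)).
have anti13 y u v : b u y v + b v y u = 0.
  exact: (alternating_antisym (h := fun u v => b u y v)).
have n23 x y : nij1 b N N N N x y y = 0.
  by rewrite /nij1 a23 add0r anti23 a23 linear0 subr0.
have n13 x y : nij1 b N N N N x y x = 0.
  by rewrite /nij1 !a13 addr0 anti13 linear0 subr0.
have [M1 M2 M3] := nij1_trilinear N N N N bL.
have [P1 P2 P3] := nij2_trilinear N N N N bL.
split; split=> // x y; try by case: (n12 x y).
- by rewrite /nij2 n23 anti23 a23 linear0 subr0 addr0.
- by rewrite /nij2 n13 a13 addr0 anti13 linear0 subr0.
Qed.

End Trilinear.

Theorem theorem5p4 (F : fieldType) (g M : lmodType F)
    (br : g -> g -> g -> g) (rho : g -> g -> M -> M) (f : M -> g)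
    (HL : is_LM3Lie br rho f)
    (N0 : {linear g -> g}) (N1 : {linear M -> M})
    (HN : is_nijenhuis br rho f N0 N1) :
  let theta := fun m : M => f (N1 m) - N0 (f m) in
  let omega1 := fun x1 x2 x3 : g =>
    br (N0 x1) x2 x3 + br x1 (N0 x2) x3 + br x1 x2 (N0 x3)
    - N0 (br x1 x2 x3) in
  let omega2 := fun x1 x2 x3 : g =>
    br (N0 x1) (N0 x2) x3 + br (N0 x1) x2 (N0 x3) + br x1 (N0 x2) (N0 x3)
    - N0 (omega1 x1 x2 x3) in
  let nu1 := fun (x1 x2 : g) (m : M) =>
    rho (N0 x1) x2 m + rho x1 (N0 x2) m + rho x1 x2 (N1 m)
    - N1 (rho x1 x2 m) in
  let nu2 := fun (x1 x2 : g) (m : M) =>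
    rho (N0 x1) (N0 x2) m + rho (N0 x1) x2 (N1 m) + rho x1 (N0 x2) (N1 m)
    - N1 (nu1 x1 x2 m) in
  is_second_order_deformation br rho f theta omega1 omega2 nu1 nu2
  /\ is_trivial_deformation br rho f theta omega1 omega2 nu1 nu2.
Proof.
move=> theta omega1 omega2 nu1 nu2.
case: HL HN => [br_alt rho_alt fL ids] [N_f N_br N_rho].
have brL : trilinear br by case: br_alt.
have rhoL : trilinear rho by case: rho_alt.
have brD := trilinear_triadditive brL.
have rhoD := trilinear_triadditive rhoL.
have fD := linear_morphD fL.
(* The given [omega1], [omega2] and [nu1], [nu2] are convertible to [nij1], [nij2] for the bracket
   and the action. *)
have [omega1_alt omega2_alt] := nij_alternating N0 br_alt.
have nu1L := nij1_trilinear N0 N0 N1 N1 rhoL.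
have nu2L := nij2_trilinear N0 N0 N1 N1 rhoL.
have nu12 := nij_alt12 N0 N1 N1 rhoL (alt2_12 rho_alt).
have thetaL : linear theta.
  move=> a u v; rewrite /theta linearP !fL linearP /= opprD addrACA.
  by rewrite -scalerN scalerDr.
have N0D : {morph N0 : u v / u + v} by apply: raddfD.
have N1D : {morph N1 : u v / u + v} by apply: raddfD.
pose T0 := id_plus_l N0; pose T1 := id_plus_l N1.
have T_br x y z : lext1 T0 (br_l br omega1 omega2 x y z)
    = lext3 (fun x y z => lconst (br x y z)) (T0 x) (T0 y) (T0 z).
  apply: nijenhuis_trivial => //.
  (* By linearity, the Nijenhuis right-hand side is [N0] applied to [omega2]. *)
  by rewrite N_br /nij2 /nij1 !linearB /= opprK addrA.
have T_rho x y m : lext1 T1 (rho_l rho nu1 nu2 x y m)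
    = lext3 (fun x y m => lconst (rho x y m)) (T0 x) (T0 y) (T1 m).
  apply: nijenhuis_trivial => //.
  by rewrite N_rho /nij2 /nij1 !linearB /= opprK addrA.
have T_f m : lext1 T0 (f_l f theta m) = lext1 (fun m => lconst (f m)) (T1 m).
  rewrite /f_l /T1 /id_plus_l (lext1D (lconst1D fD)) !(lext1cU fD).
  (* The first Nijenhuis condition annihilates the coefficient of λ^2, which is [N0 (theta m)]. *)
  rewrite (lext1_id_plusD N0D) !(lext1_id_plusU N0D) N_f monalgU0 addr0.
  by rewrite -addrA -monalgUD [N0 _ + _]addrC subrK.
split; last by exists N0, N1; split=> // m; rewrite -T_f.
have om1L : trilinear omega1 by case: omega1_alt.
have om2L : trilinear omega2 by case: omega2_alt.
have br_lD : triadditive (br_l br omega1 omega2).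
  by apply: (second_order_lD brL); apply: trilinear_triadditive.
have rho_lD : triadditive (rho_l rho nu1 nu2).
  by apply: (second_order_lD rhoL); apply: trilinear_triadditive.
have f_lD : {morph f_l f theta : m n / m + n}.
  move=> m n; rewrite /f_l fD (linear_morphD thetaL) !monalgUD.
  exact: addrACA.
split=> //.
- case: nu1L => nL1 nL2 nL3; split=> // x m; exact: (nu12 x m).1.
- case: nu2L => nL1 nL2 nL3; split=> // x m; exact: (nu12 x m).2.
(* The pullback is done for all polynomial arguments, because iterated deformed operations and the
   images under [T0], [T1] leave the constants. *)
apply: LM3Lie_identities_restrict.
apply: (LM3Lie_identities_pullback
  (lext1_id_plusD N0D) (lext1_id_plusD N1D)
  (lext1_id_plus_inj N0D) (lext1_id_plus_inj N1D)
  _ _ _ (LM3Lie_identities_lpoly brD rhoD fD ids)).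
- exact: (lext3_intertwine N0D N0D N0D N0D br_lD (lconst3D brD) T_br).
- exact: (lext3_intertwine N0D N0D N1D N1D rho_lD (lconst3D rhoD) T_rho).
- exact: (lext1_intertwine N1D N0D f_lD (lconst1D fD) T_f).
Qed.
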